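(* Let $m,q\ge2$ be integers. Let $\bm H_{m,q}=(h_{ij})_{i,j\ge0}$ be the infinite matrix with $h_{00}=(m-1)/(q-1)$, $h_{0j}=0$ for $j\ge1$, and, for $i\ge1$, $h_{i0}+h_{i1}x+\cdots+h_{ii}x^i$ equal to the $h$-polynomial of $\Delta^{(i-1)}_{m,q}$ and $h_{ij}=0$ for $j\ge i+1$. Then $\bm H_{m,q}=\widetilde{\bm F}_{m-1,q-1}$, where for positive integers $a,b$, $\widetilde{\bm F}_{a,b}=(d_{n,k})$ is the matrix with $d_{0,0}=a/b$, $d_{0,k}=0$ for $k\geq 1$, and whose $n$-th row ($n\ge1$) is the extended $f$-vector of $\Delta^{(n-1)}_{a,b}$ followed by zeros.
   Context: $[k]$ is the $0$-dimensional simplicial complex with $k$ vertices; the join is $\mathcal F*\mathcal K=\{\sigma\cup\tau:\sigma\in\mathcal F\cup\{\emptyset\},\tau\in\mathcal K\cup\{\emptyset\}\}$ on disjoint vertex sets. $\Delta^{(0)}_{a,b}=[a]$ and $\Delta^{(n)}_{a,b}=\Delta^{(n-1)}_{a,b}*[b]$. For a $d$-dimensional complex with $f_k$ faces of dimension $k$ and $f_{-1}=1$, the extended $f$-vector is $(f_{-1},\ldots,f_d)$ and the $h$-polynomial is $\sum_{k=0}^{d+1}h_kx^k$ with $h_k=\sum_{i=0}^k(-1)^{k-i}\binom{d+1-i}{d+1-k}f_{i-1}$. *)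

(* Defs.v *)
From mathcomp Require Import all_boot all_order all_algebra.
Set Implicit Arguments.
Unset Strict Implicit.
Unset Printing Implicit Defensive.
Import GRing.Theory.

(* A finite abstract simplicial complex.  The empty face is a member of
   [faces], so that f_(-1) = 1, and every element of [vertex] is a vertex. *)
Record scomplex : Type := SComplex {
  vertex : finType;
  faces : {set {set vertex}};
  faces0 : set0 \in faces;
  faces1 : forall v : vertex, [set v] \in faces;
  facesS : forall s t : {set vertex}, t \subset s -> s \in faces -> t \in faces
}.

Section Points.

Variable k : nat.

Definition points_faces : {set {set 'I_k}} := [set s : {set 'I_k} | #|s| <= 1].

Fact points_faces0 : set0 \in points_faces.
Proof. by rewrite inE cards0. Qed.

Fact points_faces1 (v : 'I_k) : [set v] \in points_faces.
Proof. by rewrite inE cards1. Qed.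

Fact points_facesS (s t : {set 'I_k}) :
  t \subset s -> s \in points_faces -> t \in points_faces.
Proof. by rewrite !inE => /subset_leq_card; apply: leq_trans. Qed.

(* The complex [k]: k vertices and no other nonempty face. *)
Definition points : scomplex :=
  SComplex points_faces0 points_faces1 points_facesS.

End Points.

Section Join.

Variables F K : scomplex.

(* The vertex sets are made disjoint by taking the sum type.  As the empty set
   is a face of F and of K, F \cup {set0} = F and K \cup {set0} = K. *)
Definition join_faces : {set {set vertex F + vertex K}} :=
  [set inl @: s :|: inr @: t | s : {set vertex F} in faces F,
                               t : {set vertex K} in faces K].

Fact join_faces0 : set0 \in join_faces.
Proof.
apply/imset2P; exists set0 set0; rewrite ?faces0 //.
by rewrite !imset0 setU0.
Qed.

Fact join_faces1 (v : vertex F + vertex K) : [set v] \in join_faces.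
Proof.
apply/imset2P; case: v => v.
  by exists [set v] set0; rewrite ?faces0 ?faces1 // imset_set1 imset0 setU0.
by exists set0 [set v]; rewrite ?faces0 ?faces1 // imset_set1 imset0 set0U.
Qed.

Fact join_facesS (s t : {set vertex F + vertex K}) :
  t \subset s -> s \in join_faces -> t \in join_faces.
Proof.
move=> /subsetP ts /imset2P[s1 s2 Fs1 Ks2 defs].
apply/imset2P; exists (inl @^-1: t) (inr @^-1: t).
- apply: facesS Fs1; apply/subsetP=> x; rewrite inE => /ts.
  by rewrite defs inE => /orP[] /imsetP[y y_in] // [->].
- apply: facesS Ks2; apply/subsetP=> x; rewrite inE => /ts.
  by rewrite defs inE => /orP[] /imsetP[y y_in] // [->].
apply/setP=> x; rewrite inE; apply/idP/orP.
  case: x => x xt; [left | right]; apply/imsetP; exists x => //; by rewrite inE.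
by case=> /imsetP[y]; rewrite inE => yt ->.
Qed.

Definition join : scomplex := SComplex join_faces0 join_faces1 join_facesS.

End Join.

Fixpoint Delta (a b n : nat) : scomplex :=
  if n is n'.+1 then join (Delta a b n') (points b) else points a.

(* A face s has dimension #|s| - 1.  This is the dimension of K as soon as K
   has a vertex; a complex without vertices gets the value 0 instead of -1. *)
Definition dim (K : scomplex) : nat := \max_(s in faces K) #|s|.-1.

(* [fnum K i] is f_(i-1): indices are shifted by one to start at f_(-1). *)
Definition fnum (K : scomplex) (i : nat) : nat :=
  #|[set s in faces K | #|s| == i]|.

Lemma fnum0 (K : scomplex) : fnum K 0 = 1.
Proof.
rewrite /fnum -(cards1 (@set0 (vertex K))); apply: eq_card => s.
by rewrite !inE cards_eq0; case: eqP => [->|]; rewrite ?faces0 ?andbF.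
Qed.

Definition ext_fvector (K : scomplex) : seq nat := mkseq (fnum K) (dim K).+2.

Local Open Scope ring_scope.

Definition hnum (K : scomplex) (k : nat) : int :=
  \sum_(0 <= i < k.+1)
     (-1) ^+ (k - i) * ('C((dim K).+1 - i, (dim K).+1 - k) * fnum K i)%N%:Z.

Definition hpoly (K : scomplex) : {poly int} :=
  \poly_(k < (dim K).+2) hnum K k.

Definition Ftilde (a b : nat) (n k : nat) : rat :=
  if n is n'.+1 then (nth 0%N (ext_fvector (Delta a b n')) k)%:R
  else if k == 0%N then a%:R / b%:R else 0.

Definition Hmat (m q : nat) (i j : nat) : rat :=
  if i is i'.+1 then
    if (j <= i)%N then ((hpoly (Delta m q i'))`_j)%:~R else 0
  else if j == 0%N then (m%:R - 1) / (q%:R - 1) else 0.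

Lemma dim_Delta (a b n : nat) :
  (0 < a)%N -> (0 < b)%N -> dim (Delta a b n) = n.
Proof.
move=> a0 b0.
have maxle s : s \in faces (Delta a b n) -> (#|s| <= n.+1)%N.
  elim: n s => [|n IHn] s /=; first by rewrite inE.
  case/imset2P=> s1 s2 Ds1; rewrite inE => Ps2 ->.
  apply: (leq_trans (leq_card_setU _ _)); rewrite -addn1 leq_add //.
    by apply: leq_trans (leq_imset_card _ _) (IHn _ Ds1).
  by apply: leq_trans (leq_imset_card _ _) Ps2.
have [s Ds cs] : exists2 s, s \in faces (Delta a b n) & #|s| = n.+1.
  elim: n {maxle} => [|n [s Ds cs]] /=.
    by exists [set Ordinal a0]; rewrite ?points_faces1 ?cards1.
  exists (inl @: s :|: inr @: [set Ordinal b0]).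
    by apply: imset2_f; rewrite ?points_faces1.
  rewrite cardsU (_ : _ :&: _ = set0) ?cards0 ?subn0.
    rewrite !card_imset ?cs ?cards1 ?addn1 //; by [move=> x y [] | move=> ? ? []].
  apply/setP=> x; rewrite !inE; apply/negP.
  by case/andP=> /imsetP[y _ ->] /imsetP[].
apply/eqP; rewrite /dim eqn_leq; apply/andP; split.
  by apply/bigmax_leqP=> t /maxle; case: #|t|.
by apply: (bigmax_sup s); rewrite ?cs.
Qed.

(* The bound j <= i in [Hmat] discards no coefficient: row i of [Hmat] is the
   whole h-polynomial. *)
Lemma Hmat_row (m q i : nat) : (0 < m)%N -> (0 < q)%N ->
  \poly_(j < i.+2) Hmat m q i.+1 j
  = map_poly (intr : int -> rat) (hpoly (Delta m q i)).
Proof.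
move=> m0 q0; apply/polyP=> j; rewrite coef_poly coef_map /= ltnS.
case: leqP => // ij; rewrite nth_default //.
by apply: leq_trans (size_poly _ _) _; rewrite dim_Delta.
Qed.

(* Main.v *)
From mathcomp Require Import all_boot all_order all_algebra.
Require Import Defs.

(** The generating polynomial of the face cardinalities turns joins into
    products, and so does its homogenised version, the [h]-polynomial, which is
    the sum of [X^|s| (1 - X)^(dim K + 1 - |s|)] over the faces [s] of [K].
    The complex [[k]] has generating polynomial [1 + k X] and [h]-polynomial
    [(1 - X) + k X], so that both sides of the identity are the coefficients of
    [(1 + (m - 1) X) (1 + (q - 1) X)^n] in the row of [Delta m q n]. *)

Set Implicit Arguments.
Unset Strict Implicit.
Unset Printing Implicit Defensive.
Import GRing.Theory.
Local Open Scope ring_scope.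

Lemma card_face (K : scomplex) (s : {set vertex K}) :
  s \in faces K -> (#|s| <= (dim K).+1)%N.
Proof.
move=> Ks; have : (#|s|.-1 <= dim K)%N by apply: (bigmax_sup s).
by case: #|s|.
Qed.

(** The weight [G] of the cardinality is arbitrary so that one computation serves both the face and
    the [h]-polynomial; the same holds for joins below. *)
Lemma sum_faces_points (V : nmodType) (k : nat) (G : nat -> V) :
  \sum_(s in faces (points k)) G #|s| = G 0%N + G 1%N *+ k.
Proof.
rewrite (bigD1 set0) ?faces0 //= cards0; congr (_ + _).
rewrite (eq_bigl [in [set [set x] | x : 'I_k]]) => [|s]; last first.
  rewrite !inE -cards_eq0; apply/idP/imsetP => [|[x _ ->]]; last first.
    by rewrite cards1.
  case/andP=> le1; rewrite -lt0n => gt0.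
  by have /cards1P[x ->] : #|s| == 1%N; [rewrite eqn_leq le1 | exists x].
rewrite big_imset /=; last by move=> x y _ _; apply: set1_inj.
under eq_bigr do rewrite cards1.
by rewrite sumr_const card_ord.
Qed.

(** A subset of the disjoint union is determined by its two traces, so faces of the join correspond
    to pairs of faces, and cardinalities add. *)
Lemma sum_faces_join (V : nmodType) (F K : scomplex) (G : nat -> V) :
  \sum_(u in faces (join F K)) G #|u|
  = \sum_(s in faces F) \sum_(t in faces K) G (#|s| + #|t|)%N.
Proof.
pose h (p : {set vertex F} * {set vertex K}) := inl @: p.1 :|: inr @: p.2.
pose g (u : {set vertex F + vertex K}) := (inl @^-1: u, inr @^-1: u).
have injl : injective (@inl (vertex F) (vertex K)) by move=> x y [].
have injr : injective (@inr (vertex F) (vertex K)) by move=> x y [].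
have inlr (A : {set vertex F}) y : (inr y \in inl @: A) = false :> bool.
  by apply/negbTE/imsetP=> -[].
have inrl (A : {set vertex K}) y : (inl y \in inr @: A) = false :> bool.
  by apply/negbTE/imsetP=> -[].
have hK : cancel h g.
  case=> s t; congr pair; apply/setP=> x;
  by rewrite !inE ?inlr ?inrl ?orbF //= mem_imset.
have gK : cancel g h.
  move=> u; apply/setP=> -[] x;
  by rewrite !inE ?inlr ?inrl ?orbF //= mem_imset ?inE.
rewrite pair_big /= (reindex h); last by exists g => ? _.
apply: eq_big => [[s t]|[s t] _] /=.
  (* A face of the join is given as the image of some pair of faces; injectivity of [h] identifies
     that pair with [(s, t)]. *)
  apply/imset2P/andP => [[s' t' Fs Kt]|[Fs Kt]]; last by exists s t.
  by move/(can_inj hK (x1 := (s, t)) (x2 := (s', t'))) => [-> ->].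
rewrite /h /= cardsU (_ : _ :&: _ = set0) ?cards0 ?subn0 ?card_imset //.
by apply/setP=> -[] x; rewrite !inE ?inlr ?inrl ?andbF.
Qed.

Definition fpoly (K : scomplex) : {poly int} := \sum_(s in faces K) 'X^#|s|.

Lemma coef_fpoly (K : scomplex) (i : nat) : (fpoly K)`_i = (fnum K i)%:R.
Proof.
rewrite coef_sum /fnum -sum1_card natr_sum.
under [RHS]eq_bigl do rewrite inE.
rewrite big_mkcondr /=; apply: eq_bigr => s _; rewrite coefXn eq_sym.
by case: eqP.
Qed.

(** Past the end of the list the default value 0 is correct, since no face has more than [dim K + 1]
    vertices. *)
Lemma nth_ext_fvector (K : scomplex) (i : nat) :
  nth 0%N (ext_fvector K) i = fnum K i.
Proof.
have [lti|gei] := ltnP i (dim K).+2; first by rewrite nth_mkseq.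
rewrite nth_default ?size_mkseq //; apply/esym/eqP; rewrite cards_eq0.
apply/eqP/setP=> s; rewrite !inE; apply/negbTE/andP=> -[/card_face le /eqP eqs].
by rewrite eqs leqNgt gei in le.
Qed.

Lemma fpoly_points (k : nat) : fpoly (points k) = 1 + 'X *+ k.
Proof. by rewrite /fpoly (sum_faces_points k (fun i => 'X^i)) expr0 expr1. Qed.

Lemma fpoly_join (F K : scomplex) : fpoly (join F K) = fpoly F * fpoly K.
Proof.
rewrite /fpoly (sum_faces_join _ _ (fun i => 'X^i)) mulr_suml.
by apply: eq_bigr => s _; rewrite mulr_sumr; apply: eq_bigr => t _; rewrite exprD.
Qed.

Lemma fpoly_Delta (a b n : nat) :
  fpoly (Delta a b n) = (1 + 'X *+ a) * (1 + 'X *+ b) ^+ n.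
Proof.
elim: n => [|n IHn]; first by rewrite fpoly_points mulr1.
by rewrite /= fpoly_join IHn fpoly_points exprSr mulrA.
Qed.

Lemma coef_XnM_1subXn (R : comNzRingType) (i e k : nat) :
  ('X^i * (1 - 'X) ^+ e : {poly R})`_k
  = if (i <= k)%N then (-1) ^+ (k - i) *+ 'C(e, k - i) else 0.
Proof.
rewrite coefXnM ltnNge; case: (i <= k)%N => //=.
rewrite exprDn coef_sum.
under eq_bigr => j _ do
  rewrite expr1n mul1r exprNn coefMn -polyC1 -polyCN -polyC_exp coefCM coefXn.
have [le|gt] := leqP (k - i) e; last first.
  rewrite bin_small // mulr0n big1 // => j _.
  by rewrite gtn_eqF ?mulr0 ?mul0rn // (leq_trans _ gt) // ltnS -ltnS.
rewrite (bigD1 (Ordinal (le : (k - i < e.+1)%N))) //= eqxx mulr1.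
rewrite big1 ?addr0 // => j /negbTE; rewrite -val_eqE /= eq_sym => ->.
by rewrite mulr0 mul0rn.
Qed.

(** Expanding each summand by the binomial theorem and grouping the faces by cardinality gives the
    alternating sum that defines [hnum]. *)
Lemma hpolyE (K : scomplex) :
  hpoly K = \sum_(s in faces K) 'X^#|s| * (1 - 'X) ^+ ((dim K).+1 - #|s|).
Proof.
apply/polyP=> k; rewrite coef_poly coef_sum.
under eq_bigr do rewrite coef_XnM_1subXn.
have [ltk|gek] := ltnP k (dim K).+2; last first.
  rewrite big1 // => s /card_face le; case: ifP => // _.
  by rewrite bin_small ?mulr0n // ltn_sub2r // (leq_ltn_trans le).
rewrite -big_mkcondr /=.
(* Only faces with at most [k] vertices remain in the sum, so [inord] keeps their cardinality
   unchanged. *)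
rewrite (partition_big (fun s : {set vertex K} => inord #|s| : 'I_k.+1) predT)
  //=.
rewrite /hnum big_mkord; apply: eq_bigr => i _.
have lei : (i <= k)%N by rewrite -ltnS.
rewrite (eq_bigl [in [set s in faces K | #|s| == i]]); last first.
  move=> s; rewrite !inE -andbA; congr andb; apply/andP/eqP => [[les /eqP <-]|->].
    by rewrite inordK.
  by rewrite lei inord_val.
under [RHS]eq_bigr => s do rewrite inE => /andP[_ /eqP ->].
rewrite sumr_const -/(fnum K i) -mulrnA PoszM -!natz -natrM mulr_natr.
(* This prepares the symmetry of binomial coefficients: with [d = dim K], choosing [d + 1 - k] out
   of [d + 1 - i] amounts to choosing [k - i]. *)
have -> : ((dim K).+1 - k = (dim K).+1 - i - (k - i))%N.
  by rewrite -subnDA subnKC.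
by rewrite bin_sub ?leq_sub2r.
Qed.

Lemma dim_points (k : nat) : (0 < k)%N -> dim (points k) = 0%N.
Proof. by move=> k0; apply: (@dim_Delta k k 0). Qed.

Lemma hpoly_points (k : nat) : (0 < k)%N -> hpoly (points k) = 1 - 'X + 'X *+ k.
Proof.
move=> k0; rewrite hpolyE dim_points //.
by rewrite (sum_faces_points k (fun i => 'X^i * (1 - 'X) ^+ (1 - i))) mul1r mulr1.
Qed.

(** The exponents of [1 - 'X] add up exactly when the dimensions add with a shift of one. This can
    fail for complexes without vertices, whose [dim] is 0, hence the hypothesis. *)
Lemma hpoly_join (F K : scomplex) :
  dim (join F K) = (dim F + dim K).+1 ->
  hpoly (join F K) = hpoly F * hpoly K.
Proof.
move=> dimFK; rewrite !hpolyE dimFK mulr_suml.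
rewrite (sum_faces_join _ _ (fun i => 'X^i * (1 - 'X) ^+ (_ - i))).
apply: eq_bigr => s /card_face les; rewrite mulr_sumr.
apply: eq_bigr => t /card_face let_; rewrite mulrACA -!exprD.
(* The bounds [les] and [let_] ensure that no natural subtraction is truncated. *)
by rewrite addnBA // addnBAC // -subnDA addSn addnS.
Qed.

Lemma hpoly_Delta (a b n : nat) : (0 < a)%N -> (0 < b)%N ->
  hpoly (Delta a b n) = (1 - 'X + 'X *+ a) * (1 - 'X + 'X *+ b) ^+ n.
Proof.
move=> a0 b0; elim: n => [|n IHn]; first by rewrite hpoly_points ?mulr1.
rewrite [LHS]/= hpoly_join; last first.
  by rewrite dim_points // (dim_Delta n.+1 a0 b0) dim_Delta // addn0.
by rewrite IHn hpoly_points // exprSr mulrA.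
Qed.

(** The shift of both parameters comes from [1 - X + (a + 1) X = 1 + a X], applied to each
    factor. *)
Lemma hpoly_Delta_fpoly (a b n : nat) :
  hpoly (Delta a.+1 b.+1 n) = fpoly (Delta a b n).
Proof.
by rewrite hpoly_Delta // fpoly_Delta !mulrS !addrA !subrK.
Qed.

Local Close Scope ring_scope.

Theorem theorem5p5 (m q : nat) (hm : 2 <= m) (hq : 2 <= q) :
  forall i j : nat, Hmat m q i j = Ftilde (m - 1) (q - 1) i j.
Proof.
case: m hm => // m _; case: q hq => // q _; rewrite !subn1 /=.
case=> [|i] j /=; first by rewrite -!natr1 !addrK.
transitivity (((hpoly (Delta m.+1 q.+1 i))`_j)%:~R : rat).
  case: leqP => // ltj; rewrite nth_default //.
  by apply: leq_trans (size_poly _ _) _; rewrite dim_Delta.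
by rewrite hpoly_Delta_fpoly coef_fpoly nth_ext_fvector rmorph_nat.
Qed.
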